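(* Let $k$ be a field of characteristic different from $2$, let $f_1,f_2\in k[X,Y]$ be independent quadratics, and let $\ell$ be a line in $k^2$ that meets the zero sets of $f_1$ and $f_2$. If $\ell$ bisects $\{f_1,f_2\}$, then $\ell$ bisects the set of quadratics in $kf_1+kf_2+k=\{\alpha f_1+\beta f_2+\lambda:\alpha,\beta,\lambda\in k\}$, and hence $\ell$ also bisects the asymptotic pencil generated by $f_1,f_2$.
   Context: Let $k$ be a field of characteristic $\neq 2$. A quadratic is a polynomial in $k[X,Y]$ of degree exactly $2$; a conic is the zero set in $k^2$ of a quadratic (recorded by its defining quadratic up to nonzero scalar). A quadratic is reducible if it is a product of two degree-one polynomials over $k$. Two quadratics $f_1,f_2$ are independent if $\deg(\alpha f_1+\beta f_2)=2$ for all $\alpha,\beta\in k$ not both $0$. A degeneration of a quadratic $f$ is a quadratic $g$ reducible over $k$ with $f-g\in k$. The asymptotic pencil generated by independent quadratics $f_1,f_2$ is the set of zero sets of degenerations of the nonzero polynomials in $kf_1+kf_2$; equivalently, the set of zero sets of the reducible quadratics in $kf_1+kf_2+k$. A line $\ell$ meets the conic defined by a quadratic $f$ if they have a common point, possibly at infinity, in the projective plane over $k$ (i.e. the projective closure of $\ell$ contains a zero of the homogenization of $f$). The line $\ell$ crosses the zero set $V(f)$ if $\ell$ is not a component of $V(f)$ and $\ell$ meets $V(f)$ in at least one point of the affine plane. In that case $\mathrm{mid}_f(\ell)$ denotes the midpoint of the two points (counted with multiplicity, one possibly at infinity) where $\ell$ meets $V(f)$: the usual midpoint if both points are affine, and the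 point at infinity $\infty$ of $\ell$ if one of the two points is at infinity. A line $\ell$ bisects a collection $\mathcal{C}$ of conics (or the quadratics defining them) with midpoint $m$ if $m=\mathrm{mid}_f(\ell)$ for all quadratics $f$ whose zero sets are in $\mathcal{C}$ and are crossed by $\ell$; if no conic in $\mathcal{C}$ is crossed by $\ell$, then $\ell$ vacuously bisects $\mathcal{C}$ (with undetermined midpoint). *)

(* Defs.v *)
From mathcomp Require Import all_boot all_order all_algebra.
From mathcomp Require Import mpoly.

Set Implicit Arguments.
Unset Strict Implicit.
Unset Printing Implicit Defensive.

Import GRing.Theory.
Local Open Scope ring_scope.

Section Conics.
Variable k : fieldType.

(* msize is the total degree plus one, and msize 0 = 0. *)
Definition quadratic (f : {mpoly k[2]}) : Prop := msize f = 3.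

Definition zero_set (f : {mpoly k[2]}) : {pred 'rV[k]_2} :=
  [pred p : 'rV[k]_2 | f.@[p 0] == 0].

Definition reducible (f : {mpoly k[2]}) : Prop :=
  exists g h : {mpoly k[2]}, [/\ msize g = 2, msize h = 2 & f = g * h].

Definition independent (f1 f2 : {mpoly k[2]}) : Prop :=
  forall a b : k, (a, b) != (0, 0) -> msize (a *: f1 + b *: f2) = 3.

Definition degeneration (f g : {mpoly k[2]}) : Prop :=
  [/\ quadratic g, reducible g & exists c : k, f - g = c%:MP].

(* A collection of zero sets is a Prop-valued predicate on subsets of k^2;
   membership is up to extensional equality of subsets. *)
Definition asymptotic_pencil (f1 f2 : {mpoly k[2]}) (S : {pred 'rV[k]_2}) :
    Prop :=
  exists (a b : k) (g : {mpoly k[2]}),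
    [/\ a *: f1 + b *: f2 != 0, degeneration (a *: f1 + b *: f2) g
      & S =i zero_set g].

Definition span_plus_consts (f1 f2 f : {mpoly k[2]}) : Prop :=
  exists a b c : k, f = a *: f1 + b *: f2 + c%:MP.

(* A line in k^2, given by a point and a direction. *)
Record line := Line {
  line_base : 'rV[k]_2;
  line_dir : 'rV[k]_2;
  line_dir_neq0 : line_dir != 0
}.

Definition line_point (l : line) (t : k) : 'rV[k]_2 :=
  line_base l + t *: line_dir l.

Definition line_poly (l : line) : {mpoly k[2]} :=
  line_dir l 0 1 *: ('X_0 - (line_base l 0 0)%:MP)
  - line_dir l 0 0 *: ('X_1 - (line_base l 0 1)%:MP).

(* The last of the three variables is the homogenizing one. *)
Definition homogenize (f : {mpoly k[2]}) : {mpoly k[3]} :=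
  \sum_(m <- msupp f)
    f@_m *: (mwiden 'X_[m] * 'X_ord_max ^+ ((msize f).-1 - mdeg m)).

Definition meets (l : line) (f : {mpoly k[2]}) : Prop :=
  exists p : 'rV[k]_3,
    [/\ p != 0, (homogenize (line_poly l)).@[p 0] = 0
      & (homogenize f).@[p 0] = 0].

Definition is_component (l : line) (f : {mpoly k[2]}) : Prop :=
  exists g : {mpoly k[2]}, f = g * line_poly l.

Definition crosses (l : line) (f : {mpoly k[2]}) : Prop :=
  ~ is_component l f /\ exists t : k, line_point l t \in zero_set f.

(* The pullback of f along t |-> line_point l t. *)
Definition restrict (l : line) (f : {mpoly k[2]}) : {poly k} :=
  mmap (@polyC k) (fun i => (line_base l 0 i)%:P + line_dir l 0 i *: 'X) f.

(* A point of the projective closure of a line is [Some t] for the affine point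
   of parameter t and [None] for the point at infinity.  The linear form in the
   homogeneous parameters (t : s) that vanishes there is t - r s, resp. s; this
   is that form at s = 1. *)
Definition linear_factor (x : option k) : {poly k} :=
  if x is Some r then 'X - r%:P else 1.

(* x and y are the two points, counted with multiplicity, where l meets the
   quadratic f: the binary quadratic form cut out by f on l is a nonzero
   multiple of the product of the forms vanishing at x and y.  Setting s = 1 is
   injective on binary quadratic forms, so this is checked after setting s = 1. *)
Definition intersection_points (l : line) (f : {mpoly k[2]})
    (x y : option k) : Prop :=
  exists2 c : k, c != 0 &
    restrict l f = c *: (linear_factor x * linear_factor y).

(* [None] is the point at infinity of l. *)
Definition midpoint (l : line) (x y : option k) : option 'rV[k]_2 :=
  if (x, y) is (Some r, Some s)
  then Some (2%:R^-1 *: (line_point l r + line_point l s)) else None.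

(* m = mid_f(l), for l crossing the quadratic f. *)
Definition is_mid (l : line) (f : {mpoly k[2]}) (m : option 'rV[k]_2) : Prop :=
  exists x y : option k, intersection_points l f x y /\ m = midpoint l x y.

Definition bisects_with (l : line) (C : {mpoly k[2]} -> Prop)
    (m : option 'rV[k]_2) : Prop :=
  forall f : {mpoly k[2]}, quadratic f -> C f -> crosses l f -> is_mid l f m.

Definition bisects (l : line) (C : {mpoly k[2]} -> Prop) : Prop :=
  exists m : option 'rV[k]_2, bisects_with l C m.

Definition bisects_conics (l : line) (CC : {pred 'rV[k]_2} -> Prop) : Prop :=
  bisects l (fun f => CC (zero_set f)).

End Conics.

(* Main.v *)
From HB Require Import structures.
Require Import Defs.
From mathcomp Require Import all_boot all_order all_algebra.
From mathcomp Require Import mpoly.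
From mathcomp Require Import ring.

(** Restricted to the line [l], parametrized by [t], a quadratic [f] becomes
    [A t^2 + B t + C] with [A], [B], [C] linear in [f].  When [l] crosses [f],
    the two intersection points are affine with parameters summing to [- B / A]
    if [A != 0], and one of them is at infinity if [A = 0]; so the midpoint
    depends only on the ratio [A : B] ([is_midE]).  Adding a constant to [f]
    changes neither [A] nor [B].

    If [l] meets [f] without crossing it then [A = B = 0]: a common point at
    infinity forces [A = 0], and then [B != 0] would produce an affine common
    point ([meets_crosses]).  Hence the hypothesis says exactly that the vectors
    [(A, B)] of [f1] and [f2] are proportional, and by linearity all quadratics
    in [k f1 + k f2 + k] have for [(A, B)] a multiple of one fixed vector
    ([bisects_proportional]).  Those crossed by [l] have a nonzero vector, so
    they share one midpoint.

    The asymptotic pencil consists of zero sets, and a zero set could a priori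
    be that of a quadratic outside [k f1 + k f2 + k].  It is not: the zero set
    of a reducible quadratic determines the quadratic up to a scalar
    ([zero_set_eqZ]).  Indeed a field of characteristic other than 2 has at
    least three elements, so a quadratic vanishing at all rational points of a
    line vanishes identically on it and is divisible by its equation. *)

Set Implicit Arguments.
Unset Strict Implicit.
Unset Printing Implicit Defensive.

Import GRing.Theory.
Local Open Scope ring_scope.

(** * Preliminaries on polynomials *)

Lemma ord2_ind (P : 'I_2 -> Prop) : P 0 -> P 1 -> forall i, P i.
Proof.
move=> P0 P1 i; have [->//|->//] : i = 0 \/ i = 1.
by case: i => [[|[|//]] i_lt2]; [left|right]; apply: val_inj.
Qed.

Lemma mpoly_ring_ind n (R : nzRingType) (P : {mpoly R[n]} -> Prop) :
    (forall c, P c%:MP) -> (forall i, P 'X_i) ->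
    (forall p q, P p -> P q -> P (p + q)) ->
    (forall p q, P p -> P q -> P (p * q)) ->
  forall p, P p.
Proof.
move=> PC PX PD PM; elim/mpolyind=> [|c m p _ _ Pp]; first by rewrite -mpolyC0.
apply: (PD) => //; rewrite -mul_mpolyC; apply: (PM) => //.
have P1 : P 1 by rewrite -mpolyC1.
rewrite mpolyXE_id; apply: (big_ind P P1 PM) => i _.
by elim: (m i) => [|e IHe]; rewrite ?expr0 // exprS; apply: (PM).
Qed.

Lemma coefM_top (R : nzRingType) (p q : {poly R}) a b :
  (size p <= a.+1)%N -> (size q <= b.+1)%N -> (p * q)`_(a + b) = p`_a * q`_b.
Proof.
move=> sz_p sz_q; rewrite coefM.
have lt_a : (a < (a + b).+1)%N by rewrite ltnS leq_addr.
rewrite (bigD1 (Ordinal lt_a)) //= addKn big1 ?addr0 // => i ne_ia.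
have [lt_ia|le_ai] := ltnP i a.
  rewrite [X in _ * X]nth_default ?mulr0 //; apply: leq_trans sz_q _.
  by rewrite -addnBAC ?(ltnW lt_ia) // -add1n leq_add2r subn_gt0.
rewrite nth_default ?mul0r //; apply: leq_trans sz_p _.
by rewrite ltn_neqAle le_ai andbT eq_sym.
Qed.

(** * Restriction of a polynomial to a line *)

Section Lines.
Variable k : fieldType.
Implicit Types (f g h : {mpoly k[2]}) (l : line k).

HB.instance Definition _ l := GRing.RMorphism.copy (restrict l)
  (mmap (@polyC k) (fun i => (line_base l 0 i)%:P + line_dir l 0 i *: 'X)).

Lemma restrictC l c : restrict l c%:MP = c%:P.
Proof. exact: mmapC. Qed.

Lemma restrictXU l i :
  restrict l 'X_i = (line_base l 0 i)%:P + line_dir l 0 i *: 'X.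
Proof. by rewrite /restrict mmapX mmap1U. Qed.

Lemma restrictZ l c f : restrict l (c *: f) = c *: restrict l f.
Proof. by rewrite -mul_mpolyC rmorphM /= restrictC mul_polyC. Qed.

Lemma restrict_line_poly l : restrict l (line_poly l) = 0.
Proof.
rewrite /line_poly rmorphB /= !restrictZ !rmorphB /= !restrictXU !restrictC.
rewrite -!mul_polyC.
ring.
Qed.

Lemma horner_restrict l f t : (restrict l f).[t] = f.@[line_point l t 0].
Proof.
elim/mpoly_ring_ind: f => [c|i|p q IHp IHq|p q IHp IHq].
- by rewrite restrictC hornerC mevalC.
- by rewrite restrictXU mevalXU !hornerE !mxE mulrC.
- by rewrite rmorphD mevalD hornerD IHp IHq.
- by rewrite rmorphM mevalM hornerM IHp IHq.
Qed.

(** An affine form on the plane whose value at [line_point l t] is [t]; it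
    retracts the plane onto the line, so that division by the equation of the
    line treats both variables alike. *)
Definition line_param l : {mpoly k[2]} :=
  if line_dir l 0 0 != 0
  then (line_dir l 0 0)^-1 *: ('X_0 - (line_base l 0 0)%:MP)
  else (line_dir l 0 1)^-1 *: ('X_1 - (line_base l 0 1)%:MP).

Lemma line_dir_coord_neq0 l : line_dir l 0 0 = 0 -> line_dir l 0 1 != 0.
Proof.
move=> u0; apply: contra (line_dir_neq0 l) => /eqP v0.
by apply/eqP/rowP; elim/ord2_ind; rewrite mxE.
Qed.

Lemma line_param_congr l i :
  exists g, 'X_i - ((line_base l 0 i)%:MP + line_dir l 0 i *: line_param l)
            = g * line_poly l.
Proof.
rewrite /line_param /line_poly; move: (@line_dir_coord_neq0 l).
set u := line_dir l 0 0; set v := line_dir l 0 1; move=> uv_neq0.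
have [u0|u_neq0] /= := eqVneq u 0; elim/ord2_ind: i; rewrite -/u -/v ?u0.
- exists (v^-1)%:MP; rewrite scale0r !scale0r subr0 addr0 mul_mpolyC scalerA.
  by rewrite mulVf ?scale1r // uv_neq0.
- by exists 0; rewrite scalerA divff ?uv_neq0 // scale1r; ring.
- by exists 0; rewrite scalerA divff // scale1r; ring.
- have uV : (u^-1)%:MP * u%:MP = 1 :> {mpoly k[2]}.
    by rewrite -mpolyCM mulVf // mpolyC1.
  exists (- (u^-1)%:MP); rewrite -!mul_mpolyC.
  ring: uV.
Qed.

(** Modulo the equation of [l], each variable equals its expression along [l] at
    the parameter [line_param l]; being a congruence of ring morphisms, this
    extends from the variables to every [f]. *)
Lemma restrict_congr l f :
  exists g, f - (map_poly (@mpolyC 2 k) (restrict l f)).[line_param l]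
            = g * line_poly l.
Proof.
elim/mpoly_ring_ind: f => [c|i|p q [gp IHp] [gq IHq]|p q [gp IHp] [gq IHq]].
- by exists 0; rewrite restrictC map_polyC /= hornerC subrr mul0r.
- rewrite restrictXU rmorphD /= map_polyC /= map_polyZ /= map_polyX !hornerE.
  by rewrite mul_mpolyC; apply: line_param_congr.
- by exists (gp + gq); rewrite !rmorphD hornerD mulrDl -IHp -IHq; ring.
- exists (p * gq + gp * (map_poly (@mpolyC 2 k) (restrict l q)).[line_param l]).
  rewrite !rmorphM hornerM mulrDl -[p * gq * _]mulrA -IHq mulrAC -IHp.
  ring.
Qed.

Lemma restrict_eq0 l f : restrict l f = 0 <-> is_component l f.
Proof.
split=> [lf0|[g ->]]; last by rewrite rmorphM /= restrict_line_poly mulr0.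
have [g] := restrict_congr l f; rewrite lf0 rmorph0 horner0 subr0.
by exists g.
Qed.

(** The leading coefficient along [l] sees only the direction of [l]: this is
    what ties the coefficients of [restrict] to the homogenization at
    infinity. *)
Lemma restrict_monomial l (m : 'X_{1..2}) :
  (size (restrict l 'X_[m]) <= (mdeg m).+1)%N /\
  (restrict l 'X_[m])`_(mdeg m) = \prod_i line_dir l 0 i ^+ m i.
Proof.
rewrite mdegE mpolyXE_id rmorph_prod /=.
pose K (p : {poly k}) e c := (size p <= e.+1)%N /\ p`_e = c.
have KM p1 e1 c1 p2 e2 c2 :
  K p1 e1 c1 -> K p2 e2 c2 -> K (p1 * p2) (e1 + e2)%N (c1 * c2).
  move=> [s1 <-] [s2 <-]; split; last by rewrite coefM_top.
  apply: leq_trans (size_polyMleq _ _) _.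
  by have := leq_add s1 s2; rewrite addSn addnS; case: (size p1 + size p2)%N.
apply: (big_ind3 K) => [||i _]; first 2 last.
- rewrite rmorphXn /= restrictXU; elim: (m i) => [|e IHe].
    by split; rewrite ?expr0 ?size_poly1 ?coefC.
  rewrite !exprS -[e.+1]add1n; apply: KM => //; split; last first.
    by rewrite coefD coefC coefZ coefX mulr1 add0r.
  apply: leq_trans (size_polyD _ _) _; rewrite geq_max size_polyC.
  by rewrite (leq_trans (size_scale_leq _ _)) ?size_polyX // andbT;
    case: (_ != _).
- by split; rewrite ?size_poly1 ?coefC.
- by move=> *; apply: KM.
Qed.

Lemma size_restrict l f : (size (restrict l f) <= msize f)%N.
Proof.
rewrite {1}[f]mpolyE rmorph_sum /= (leq_trans (size_sum _ _ _)) //.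
rewrite big_seq; apply/bigmax_leqP_seq => m m_f _.
rewrite restrictZ (leq_trans (size_scale_leq _ _)) //.
by rewrite (leq_trans (restrict_monomial l m).1) ?msize_mdeg_lt.
Qed.

(** * Meeting a conic, possibly at infinity *)

Lemma homogenizeE f (p : 'I_3 -> k) :
  (homogenize f).@[p] = \sum_(m <- msupp f)
    f@_m * ((\prod_i p (widen_ord (leqnSn 2) i) ^+ m i)
            * p ord_max ^+ ((msize f).-1 - mdeg m)).
Proof.
rewrite /homogenize raddf_sum /=; apply: eq_bigr => m _.
rewrite mevalZ mevalM rmorphXn /= mevalXU mwidenX mevalX big_ord_recr /=.
rewrite mnmwiden_ordmax expr0 mulr1; congr (_ * (_ * _)).
by apply: eq_bigr => i _; rewrite mnmwiden_widen.
Qed.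

Lemma homogenize_affine f (p : 'I_3 -> k) : p ord_max != 0 ->
  (homogenize f).@[p] = p ord_max ^+ (msize f).-1
     * f.@[fun i => p (widen_ord (leqnSn 2) i) / p ord_max].
Proof.
move=> z_neq0; rewrite homogenizeE mevalE mulr_sumr big_seq [RHS]big_seq.
apply: eq_bigr => m /msize_mdeg_lt m_lt.
rewrite [RHS]mulrCA; congr (_ * _).
under [in RHS]eq_bigr do rewrite expr_div_n.
rewrite prodf_div prodrXr -mdegE [RHS]mulrCA; congr (_ * _).
rewrite expfB_cond // (negbTE z_neq0) add0n -ltnS prednK //.
exact: leq_trans m_lt.
Qed.

(** At infinity only the monomials of top degree survive in the homogenization,
    and likewise in the top coefficient along [l]; the factor [s] allows an
    arbitrary representative of the point at infinity of [l]. *)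
Lemma homogenize_infinity l f (p : 'I_3 -> k) s :
    p ord_max = 0 ->
    (forall i, p (widen_ord (leqnSn 2) i) = s * line_dir l 0 i) ->
  (homogenize f).@[p] = s ^+ (msize f).-1 * (restrict l f)`_(msize f).-1.
Proof.
move=> z0 p_dir; rewrite homogenizeE [f in restrict l f]mpolyE rmorph_sum /=.
rewrite coef_sum mulr_sumr big_seq [RHS]big_seq; apply: eq_bigr => m /msize_mdeg_lt m_lt.
rewrite restrictZ coefZ z0 [RHS]mulrCA; congr (_ * _).
have [sz_m top_m] := restrict_monomial l m.
have [<-|ne_d] := eqVneq (mdeg m) (msize f).-1.
  rewrite subnn mulr1 top_m.
  under eq_bigr do rewrite p_dir exprMn.
  by rewrite big_split prodrXr -mdegE.
have lt_d : (mdeg m < (msize f).-1)%N.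
  by rewrite ltn_neqAle ne_d -ltnS prednK // (leq_trans _ m_lt).
rewrite nth_default ?(leq_trans sz_m) //.
by rewrite expr0n subn_eq0 leqNgt lt_d !mulr0.
Qed.

Lemma line_poly_neq0 l : line_poly l != 0.
Proof.
apply: contra (line_dir_neq0 l) => /eqP L0; apply/eqP/rowP.
have LU i : (line_poly l)@_U_(i) = 0 by rewrite L0 mcoeff0.
move: (LU 0) (LU 1); rewrite /line_poly !mcoeffB !mcoeffZ !mcoeffB !mcoeffC.
rewrite !mcoeffXU -!mdeg_eq0 !mdeg1 !mulr0 !subr0 !mulr0 !mulr1 subr0 sub0r.
by move=> v0 /eqP; rewrite oppr_eq0 => /eqP u0; elim/ord2_ind; rewrite mxE.
Qed.

Lemma msize_line_poly l : msize (line_poly l) = 2.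
Proof.
apply/eqP; rewrite eqn_leq; apply/andP; split; last first.
  rewrite ltnNge; apply/negP => /msize1_polyC L_cst.
  have := restrict_line_poly l; rewrite L_cst restrictC => /eqP.
  rewrite polyC_eq0 => /eqP c0; move: (line_poly_neq0 l).
  by rewrite L_cst c0 mpolyC0 eqxx.
have le2 c i (a : k) : (msize (c *: ('X_i - a%:MP) : {mpoly k[2]}) <= 2)%N.
  apply: leq_trans (msizeZ_le _ _) _; apply: leq_trans (msizeD_le _ _) _.
  by rewrite geq_max msizeX mdeg1 msizeN msizeC; case: (_ != _).
by apply: leq_trans (msizeD_le _ _) _; rewrite msizeN geq_max !le2.
Qed.

Lemma line_poly_root l (p : 'I_2 -> k) :
  (line_poly l).@[p] = 0 -> exists t, line_point l t 0 =1 p.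
Proof.
move=> Lp0; exists (line_param l).@[p] => i.
have [g /(congr1 (meval p))] := line_param_congr l i.
rewrite mevalB mevalD mevalZ mevalM mevalC mevalXU Lp0 mulr0 !mxE mulrC.
by move/eqP; rewrite subr_eq0 => /eqP ->; rewrite mulrC.
Qed.

(** A common point at infinity kills the coefficient of [t^2]; the restriction
    is then affine in [t], and it has a root as soon as the coefficient of [t]
    does not vanish. *)
Lemma meets_crosses l f : quadratic f -> meets l f ->
  (restrict l f)`_2 != 0 \/ (restrict l f)`_1 != 0 -> crosses l f.
Proof.
move=> f2 [p [p_neq0 Lp0 fp0]] AB_neq0; split.
  move/restrict_eq0=> lf0; case: AB_neq0; by rewrite lf0 coef0 eqxx.
have [z0|z_neq0] := eqVneq (p 0 ord_max) 0; last first.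
  move: Lp0 fp0; rewrite !homogenize_affine // f2 msize_line_poly.
  move=> /eqP; rewrite mulf_eq0 expf_eq0 (negbTE z_neq0) andbF /= => /eqP.
  move=> /line_poly_root[t tE] /eqP; rewrite mulf_eq0 expf_eq0 (negbTE z_neq0).
  by exists t; rewrite inE (meval_eq _ tE).
(* The point is at infinity: its first two coordinates [w] are a multiple of
   the direction of [l], as is seen by applying [homogenize_infinity] to the
   line of direction [w]. *)
pose w : 'rV[k]_2 := \row_i p 0 (widen_ord (leqnSn 2) i).
have w_neq0 : w != 0.
  apply: contra p_neq0 => /eqP/rowP w0; apply/eqP/rowP => i; rewrite mxE.
  have [j|] := unliftP ord_max i; last by move->.
  move=> ->; have := w0 j; rewrite !mxE => <-; congr (p 0 _).
  by apply: val_inj; rewrite /= /bump leqNgt ltn_ord.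
have := @homogenize_infinity (Line (line_base l) w_neq0) (line_poly l) _ 1 z0.
rewrite Lp0 expr1n mul1r msize_line_poly /= => /(_ _)/esym.
have wE i : p 0 (widen_ord (leqnSn 2) i) = 1 * w 0 i by rewrite mul1r mxE.
move=> /(_ wE); rewrite /line_poly rmorphB /= !restrictZ !rmorphB /=.
rewrite !restrictXU !restrictC /= !(coefB, coefZ, coefD, coefC, coefX) /=.
rewrite !add0r !subr0 !mulr1 => /eqP; rewrite subr_eq0 => /eqP vx_uy.
have [s s_neq0 sE] : exists2 s, s != 0 & w = s *: line_dir l.
  have [s sE] : exists s, w = s *: line_dir l.
    have [u0|u_neq0] := eqVneq (line_dir l 0 0) 0.
      have v_neq0 := line_dir_coord_neq0 u0.
      exists (w 0 1 / line_dir l 0 1); apply/rowP; elim/ord2_ind.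
        rewrite [RHS]mxE u0 mulr0; apply: (mulfI v_neq0).
        by rewrite vx_uy u0 mul0r mulr0.
      by rewrite [RHS]mxE divfK.
    exists (w 0 0 / line_dir l 0 0); apply/rowP; elim/ord2_ind.
      by rewrite [RHS]mxE divfK.
    rewrite [RHS]mxE; apply: (mulfI u_neq0); rewrite -vx_uy.
    field.
    exact: u_neq0.
  exists s => //; apply: contra w_neq0 => /eqP s0; by rewrite sE s0 scale0r.
have := @homogenize_infinity l f (p 0) s z0.
have wsE i : p 0 (widen_ord (leqnSn 2) i) = s * line_dir l 0 i.
  by rewrite wE mul1r sE mxE.
rewrite fp0 f2 /= => /(_ wsE)/esym/eqP.
rewrite mulf_eq0 expf_eq0 (negbTE s_neq0) /= => /eqP A0.
have B_neq0 : (restrict l f)`_1 != 0 by case: AB_neq0; rewrite ?A0 ?eqxx.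
exists (- (restrict l f)`_0 / (restrict l f)`_1).
have sz_q : (size (restrict l f) <= 3)%N.
  by rewrite (leq_trans (size_restrict l f)) ?f2.
rewrite inE -horner_restrict (horner_coef_wide _ sz_q).
rewrite !big_ord_recl big_ord0 /= A0 mul0r !addr0 expr0 expr1 mulr1.
by rewrite mulrC divfK // subrr.
Qed.

(** * Midpoints *)

Lemma restrict_quadratic l f : quadratic f ->
  restrict l f = (restrict l f)`_2 *: 'X^2 + (restrict l f)`_1 *: 'X
                 + ((restrict l f)`_0)%:P.
Proof.
move=> f2.
have sz_q : (size (restrict l f) <= 3)%N.
  by rewrite (leq_trans (size_restrict l f)) ?f2.
apply/polyP => -[|[|[|i]]]; rewrite !coefD !coefZ coefXn coefX coefC /=.
- by rewrite !mulr0 !add0r.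
- by rewrite mulr0 mulr1 add0r addr0.
- by rewrite mulr1 mulr0 !addr0.
- by rewrite !mulr0 !addr0 nth_default // (leq_trans sz_q).
Qed.

(** The midpoint cut out on [l] by [A t^2 + B t + C], as a function of the
    point [A : B] of the projective line. *)
Definition mid_of_coefs l (A B : k) : option 'rV[k]_2 :=
  if A == 0 then None else Some (line_point l (- B / (2%:R * A))).

Lemma mid_of_coefsZ l c A B : c != 0 ->
  mid_of_coefs l (c * A) (c * B) = mid_of_coefs l A B.
Proof.
move=> c_neq0; rewrite /mid_of_coefs mulf_eq0 (negbTE c_neq0) /=.
have [//|A_neq0] := eqVneq A 0.
by rewrite -mulrN [2%:R * _]mulrCA -mulf_div divff ?mul1r.
Qed.

Lemma midpoint_Some l r s : 2%:R != 0 :> k ->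
  midpoint l (Some r) (Some s) = Some (line_point l ((r + s) / 2%:R)).
Proof.
move=> two_neq0; congr Some; apply/rowP => i; rewrite !mxE.
field.
exact: two_neq0.
Qed.

Lemma line_point_inj l : injective (line_point l).
Proof.
move=> r s /addrI/eqP; rewrite -subr_eq0 -scalerBl scaler_eq0.
by rewrite (negbTE (line_dir_neq0 l)) orbF subr_eq0 => /eqP.
Qed.

(** By Vieta the sum of the two parameters is [- B / A]; conversely a crossing
    provides one root [t], hence a full factorization, the other root being
    [- B / A - t], or the point at infinity if [A = 0]. *)
Lemma is_midE l f m : 2%:R != 0 :> k -> quadratic f -> crosses l f ->
  is_mid l f m <-> m = mid_of_coefs l (restrict l f)`_2 (restrict l f)`_1.
Proof.
move=> two_neq0 f2 [lf_neq0 [t]].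
rewrite inE -horner_restrict /is_mid /intersection_points => /eqP.
have /(contra_not (restrict_eq0 l f).1) : ~ is_component l f by [].
have := restrict_quadratic l f2; move: (restrict l f)`_2 (restrict l f)`_1.
move: (restrict l f) (restrict l f)`_0 => q C A B qE q_neq0 qt0.
split=> [[x [y [[c c_neq0 qxy] ->]]]|->].
  have -> : A = q`_2.
    by rewrite qE !coefD !coefZ coefXn coefX coefC /= mulr1 mulr0 !addr0.
  have -> : B = q`_1.
    by rewrite qE !coefD !coefZ coefXn coefX coefC /= mulr0 mulr1 add0r addr0.
  case: x y qxy => [r|] [s|] /= ->.
  - have -> : ('X - r%:P) * ('X - s%:P) = 'X^2 - (r + s) *: 'X + (r * s)%:P.
      rewrite -mul_polyC polyCD polyCM.
      ring.
    rewrite /mid_of_coefs !coefE /= !mulr0 !mulr1 !subr0 !addr0 sub0r.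
    rewrite mulr1 (negbTE c_neq0) midpoint_Some //.
    congr (Some (line_point l _)).
    field.
    by rewrite c_neq0 two_neq0.
  - by rewrite /mid_of_coefs mulr1 !coefE /= subr0 mulr0 eqxx.
  - by rewrite /mid_of_coefs mul1r !coefE /= subr0 mulr0 eqxx.
  - by rewrite /mid_of_coefs mul1r !coefE /= mulr0 eqxx.
have CE : C = - (A * t ^+ 2 + B * t).
  by apply/eqP; rewrite -subr_eq0 opprK addrC -qt0 qE !hornerE.
rewrite /mid_of_coefs; have [A0|A_neq0] := eqVneq A 0.
  exists (Some t), None; split=> //; exists B.
    apply: contra_not_neq q_neq0 => B0.
    by rewrite qE CE A0 B0 !mul0r !scale0r !addr0 oppr0 polyC0 addr0.
  rewrite qE CE A0 scale0r mul0r !add0r mulr1 scalerBr -mul_polyC.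
  by rewrite polyCN polyCM mul_polyC mul_polyC.
exists (Some t), (Some (- B / A - t)); split.
  exists A => //; rewrite qE CE; have BE : B = - (A * (- B / A - t + t)).
    by rewrite subrK mulrCA divff // mulr1 opprK.
  move: (- B / A - t) BE => s ->.
  rewrite /= -!mul_polyC polyCN !(polyCM, polyCD, polyCN, polyC_exp).
  ring.
rewrite midpoint_Some //; congr (Some (line_point l _)).
field.
by rewrite A_neq0 two_neq0.
Qed.

(** * Recovering a reducible quadratic from its zero set *)

Lemma line_poly_dvd l l' : is_component l (line_poly l') ->
  exists2 c, c != 0 & line_poly l' = c *: line_poly l.
Proof.
move=> [g gE]; have g_neq0 : g != 0.
  by apply: contra (line_poly_neq0 l') => /eqP g0; rewrite gE g0 mul0r.
have := congr1 (fun f => msize f) gE.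
rewrite msizeM ?line_poly_neq0 // !msize_line_poly addnS addn1 /=.
case=> /esym/eqP/msize_poly1P[c c_neq0 g_cst]; exists c => //.
by rewrite gE g_cst mul_mpolyC.
Qed.

Lemma linear_line_poly g : msize g = 2%N -> exists l, g = line_poly l.
Proof.
move=> g2; pose row2 (x y : k) : 'rV[k]_2 := \row_i (if i == 0 then x else y).
have gE : g = g@_U_(0) *: 'X_0 + g@_U_(1) *: 'X_1 + (g@_0)%:MP.
  apply/mpolyP => m; rewrite !mcoeffD !mcoeffZ mcoeffC.
  have [m2|] := leqP 2 (mdeg m).
    rewrite memN_msupp_eq0 ?msize_mdeg_ge ?g2 // !mcoeffX.
    have mU i : (U_(i)%MM == m) = false.
      by apply: contraTF m2 => /eqP <-; rewrite mdeg1.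
    by rewrite !mU -mdeg_eq0 (gtn_eqF (ltnW m2)) !mulr0 !addr0.
  rewrite ltnS leq_eqVlt ltnS leqn0 => /orP[/mdeg1P[i /eqP ->]|].
    rewrite !mcoeffXU -mdeg_eq0 mdeg1 mulr0 addr0.
    by elim/ord2_ind: i; rewrite /= mulr1 mulr0 ?addr0 ?add0r.
  rewrite mdeg_eq0 => /eqP ->; rewrite !mcoeffX eqxx -!mdeg_eq0 !mdeg1 /=.
  by rewrite !mulr0 !add0r mulr1.
set a := g@_U_(0) in gE *; set b := g@_U_(1) in gE *; set c := g@_0 in gE *.
have ab_neq0 : a = 0 -> b != 0.
  move=> a0; apply/eqP => b0; move: g2; rewrite gE a0 b0 !scale0r !add0r.
  by rewrite msizeC; case: (_ != _).
have dir_neq0 : row2 (- b) a != 0.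
  apply/eqP => /rowP d0; move: (d0 0) (d0 1); rewrite !mxE /= => /eqP.
  by rewrite oppr_eq0 => /eqP b0 /ab_neq0; rewrite b0 eqxx.
have [base baseE] : exists base : 'rV[k]_2, a * base 0 0 + b * base 0 1 = - c.
  have [a0|a_neq0] := eqVneq a 0.
    exists (row2 0 (- c / b)); rewrite !mxE /= a0 mul0r add0r mulrC divfK //.
    exact: ab_neq0.
  by exists (row2 (- c / a) 0); rewrite !mxE /= mulr0 addr0 mulrC divfK.
exists (Line base dir_neq0); rewrite {1}gE /line_poly /= !mxE /=.
have -> : c = - (a * base 0 0 + b * base 0 1) by rewrite baseE opprK.
rewrite -!mul_mpolyC !(mpolyCD, mpolyCM, mpolyCN).
ring.
Qed.

(** The restriction has degree at most 2 and vanishes at the three distinct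
    parameters [0], [1], [-1]. *)
Lemma vanish_component l f : 2%:R != 0 :> k -> quadratic f ->
  (forall t, line_point l t \in zero_set f) -> is_component l f.
Proof.
move=> two_neq0 f2 lf; apply/restrict_eq0/eqP/contraT => q_neq0.
have := max_poly_roots q_neq0 => /(_ [:: 0; 1; -1]) /=.
have rt t : root (restrict l f) t.
  by rewrite rootE horner_restrict; have := lf t; rewrite inE.
rewrite !rt /= !inE !negb_or !andbT eq_sym oner_neq0 eq_sym oppr_eq0 oner_neq0.
rewrite -addr_eq0 two_neq0 => /(_ isT isT).
by rewrite ltnNge (leq_trans (size_restrict l f)) ?f2.
Qed.

(** If [g] is the product of the equations of [l1] and [l2] then [f] vanishes on
    [l1], so it is the product of the equations of [l1] and some [l3], and the
    restriction of this product to [l2] is zero.  Either [l3 = l2], or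
    [l1 = l2]; in the second case [g] is a square vanishing on [l3], so again
    [l3 = l2]. *)
Lemma zero_set_eqZ f g : 2%:R != 0 :> k -> quadratic f -> quadratic g ->
  reducible g -> zero_set f =i zero_set g -> exists2 c, c != 0 & f = c *: g.
Proof.
move=> two_neq0 f2 g2 [L1 [L2 [/linear_line_poly[l1 ->]]]].
move=> /linear_line_poly[l2 ->] gE fg.
have on_line l t : (line_poly l).@[line_point l t 0] = 0.
  by rewrite -horner_restrict restrict_line_poly horner0.
have comp1 : is_component l1 f.
  apply: vanish_component => // t.
  by rewrite fg inE gE mevalM on_line mul0r.
have comp2 : is_component l2 f.
  apply: vanish_component => // t.
  by rewrite fg inE gE mevalM on_line mulr0.
have [h fE] := comp1.
have h_neq0 : h != 0.
  apply/eqP => h0; move: f2; rewrite /quadratic fE h0 mul0r.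
  by rewrite (eqP (_ : msize 0 == 0%N)) // msize_poly_eq0.
have /linear_line_poly[l3 hE] : msize h = 2%N.
  move: f2; rewrite /quadratic fE msizeM ?line_poly_neq0 //.
  by rewrite msize_line_poly addn2 /= => -[].
move/restrict_eq0: comp2 => /eqP; rewrite fE hE rmorphM mulf_eq0.
case/orP=> /eqP/restrict_eq0/line_poly_dvd[c c_neq0 cE].
  by exists c; rewrite // gE cE -scalerAl mulrC.
have /restrict_eq0/eqP : is_component l3 g.
  apply: vanish_component => // t.
  by rewrite -fg inE fE hE mevalM on_line mul0r.
rewrite gE cE -scalerAl restrictZ scaler_eq0 (negbTE c_neq0) rmorphM mulf_eq0.
rewrite orbb => /eqP/restrict_eq0/line_poly_dvd[d d_neq0 dE].
exists d^-1; rewrite ?invr_eq0 //.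
rewrite -scalerAr scalerA [d^-1 * c]mulrC -scalerA {2}dE -scalerAl.
by rewrite [d^-1 *: _]scalerA mulVf ?scale1r.
Qed.

(** * Quadratics spanned by two bisected ones *)

(** Each [f_i] either is not crossed, and then has zero coefficients, or is
    crossed with the common midpoint, which determines the ratio of its
    coefficients; so the two coefficient vectors are proportional. *)
Lemma bisects_proportional l f1 f2 : 2%:R != 0 :> k ->
    quadratic f1 -> quadratic f2 -> meets l f1 -> meets l f2 ->
    bisects l (fun f => f = f1 \/ f = f2) ->
  exists A B : k, forall f, span_plus_consts f1 f2 f ->
    exists c, (restrict l f)`_2 = c * A /\ (restrict l f)`_1 = c * B.
Proof.
move=> two_neq0 q1 q2 m1 m2 [m bis].
pose A f := (restrict l f)`_2; pose B f := (restrict l f)`_1.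
have crossP f : quadratic f -> meets l f ->
    A f = 0 /\ B f = 0 \/ (A f = 0 -> B f != 0) /\ crosses l f.
  move=> qf mf; have [A0|A_neq0] := eqVneq (A f) 0; last first.
    right; split=> [A0|]; first by rewrite A0 eqxx in A_neq0.
    by apply: meets_crosses => //; left.
  have [B0|B_neq0] := eqVneq (B f) 0; first by left.
  by right; split=> //; apply: meets_crosses => //; right.
(* The claim for [f1] and [f2] suffices: constants do not contribute to the
   coefficients of degree 1 and 2. *)
suff [A0 [B0 prop]] : exists A0 B0, forall f, f = f1 \/ f = f2 ->
    exists c, A f = c * A0 /\ B f = c * B0.
  exists A0, B0 => f [a [b [c ->]]].
  have [c1 [A1 B1]] := prop f1 (or_introl erefl).
  have [c2 [A2 B2]] := prop f2 (or_intror erefl).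
  exists (a * c1 + b * c2); rewrite !rmorphD /= !restrictZ restrictC.
  rewrite !coefD !coefZ !coefC /= !addr0 -/(A f1) -/(A f2) -/(B f1) -/(B f2).
  by rewrite A1 A2 B1 B2 !mulrDl !mulrA.
have mid f : f = f1 \/ f = f2 -> crosses l f -> m = mid_of_coefs l (A f) (B f).
  move=> f12 cf; have qf : quadratic f by case: f12 => ->.
  by apply/is_midE => //; apply: bis.
have [[A1 B1]|[AB1 cr1]] := crossP _ q1 m1.
  exists (A f2), (B f2) => f [->|->]; last by exists 1; rewrite !mul1r.
  by exists 0; rewrite !mul0r.
exists (A f1), (B f1) => f [->|->]; first by exists 1; rewrite !mul1r.
have [[A2 B2]|[AB2 cr2]] := crossP _ q2 m2; first by exists 0; rewrite !mul0r.
have := mid _ (or_intror erefl) cr2; rewrite (mid _ (or_introl erefl) cr1).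
rewrite /mid_of_coefs; have [A1|A1_neq0] := eqVneq (A f1) 0.
  have [A2 _|//] := eqVneq (A f2) 0.
  by exists (B f2 / B f1); rewrite A1 A2 mulr0 divfK ?AB1.
have [//|A2_neq0 [/line_point_inj B12]] := eqVneq (A f2) 0.
exists (A f2 / A f1); rewrite divfK //; split=> //.
transitivity (- (2%:R * A f2) * (- B f2 / (2%:R * A f2))).
  by field; rewrite A2_neq0 two_neq0.
by rewrite -B12; field; rewrite A1_neq0 two_neq0.
Qed.

End Lines.

(** * Bisection of the spanned quadratics and of the asymptotic pencil *)

Theorem theorem5p3 (k : fieldType) (hk : 2%N \notin [pchar k]%R)
    (f1 f2 : {mpoly k[2]}) (hf1 : quadratic f1) (hf2 : quadratic f2)
    (hind : independent f1 f2) (l : line k)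
    (hm1 : meets l f1) (hm2 : meets l f2)
    (hbis : bisects l (fun f => f = f1 \/ f = f2)) :
  bisects l (span_plus_consts f1 f2) /\
  bisects_conics l (asymptotic_pencil f1 f2).
Proof.
have two_neq0 : 2%:R != 0 :> k by move: hk; rewrite inE.
have [A [B prop]] := bisects_proportional two_neq0 hf1 hf2 hm1 hm2 hbis.
have bis : bisects_with l (span_plus_consts f1 f2) (mid_of_coefs l A B).
  move=> f qf /prop[c [fA fB]] cf; apply/is_midE => //; rewrite fA fB.
  (* A zero factor would make the restriction constant, hence zero since [l]
     crosses [f]. *)
  rewrite mid_of_coefsZ //; apply: contra_not_neq cf.1 => c0.
  apply/restrict_eq0; move: cf.2 => [t].
  rewrite inE -horner_restrict restrict_quadratic // fA fB c0 !mul0r !scale0r.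
  by rewrite !add0r hornerC => /eqP ->.
split; first by exists (mid_of_coefs l A B).
exists (mid_of_coefs l A B) => f qf [a [b [g [_ [qg red_g [c gE]] fg]]]] cf.
apply: bis => //.
have [d _ ->] := zero_set_eqZ two_neq0 qf qg red_g fg.
exists (d * a), (d * b), (- (d * c)).
rewrite mpolyCN mpolyCM mul_mpolyC -gE -!scalerA -scalerDr -scalerBr.
by rewrite opprB addrC subrK.
Qed.
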